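(* Let $\mathcal H$ be a real Hilbert space, $t_0>0$, let $f:\mathcal H\to\mathbb R$ be convex and $\mathcal C^1$ with $L$-Lipschitz continuous gradient and nonempty set of minimizers. Let $\alpha>3$, $\gamma>0$, $\beta\ge0$, $\beta(t)=\gamma+\beta/t$, let $b\in]0,\alpha-1]$ and $$a(t)=t^2\left(1+\frac{(\alpha-b)\gamma t-\beta(\alpha+1-b)}{t^2-\alpha\gamma t-\beta(\alpha+1)}\right),\qquad m(t)=\max\big(t,\,L|a(t)\beta(t)|,\,L|a(t)|\beta(t)^2\big).$$ Let $e\in\mathcal C([t_0,+\infty[;\mathcal H)$ with $m(\cdot)e(\cdot)\in L^1(t_0,+\infty;\mathcal H)$, and let $x$ be a solution of $$\ddot x(t)+\frac\alpha t\dot x(t)+\nabla f\big(x(t)+\beta(t)\dot x(t)\big)+e(t)=0.$$ Then: (i) $f(x(t)+\beta(t)\dot x(t))-\min_{\mathcal H}f=\mathcal O(1/t^2)$ as $t\to+\infty$; (ii) $\|\dot x(t)\|=\mathcal O(1/t)$ as $t\to+\infty$; (iii) $\int_{t_0}^{+\infty}t\,(f(x(t))-\min_{\mathcal H}f)dt<+\infty$; (iv) $\int_{t_0}^{+\infty}t^2\|\nabla f(x(t)+\beta(t)\dot x(t))\|^2dt<+\infty$; (v) $\int_{t_0}^{+\infty}t\|\dot x(t)\|^2dt<+\infty$. *)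

(* Defs.v *)
From HB Require Import structures.
From mathcomp Require Import all_boot all_order all_algebra.
From mathcomp Require Import all_classical all_reals all_analysis.
Set Implicit Arguments. Unset Strict Implicit. Unset Printing Implicit Defensive.
Import Order.TTheory GRing.Theory Num.Theory.
Import numFieldNormedType.Exports.
Local Open Scope classical_set_scope.
Local Open Scope ring_scope.

Section Defs.
Variable R : realType.

(* ip is an inner product on the complete normed space V inducing its norm:
   (V, ip) is then a real Hilbert space. *)
Definition is_inner_product (V : normedModType R) (ip : V -> V -> R) : Prop :=
  [/\ (forall x y, ip x y = ip y x),
      (forall a x y z, ip (a *: x + y) z = a * ip x z + ip y z) &
      (forall x, ip x x = `|x| ^+ 2)].

Definition is_gradient (V : normedModType R) (ip : V -> V -> R)
    (f : V -> R) (g : V -> V) : Prop :=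
  forall x, differentiable f x /\ ('d f x : V -> R) = (fun h => ip (g x) h).

Definition convex_fun (V : normedModType R) (f : V -> R) : Prop :=
  forall x y (l : R), 0 <= l -> l <= 1 ->
    f (l *: x + (1 - l) *: y) <= l * f x + (1 - l) * f y.

Definition lipschitz_with (V : normedModType R) (L : R) (g : V -> V) : Prop :=
  forall x y, `|g x - g y| <= L * `|x - y|.

Definition betaf (gamma beta0 t : R) : R := gamma + beta0 / t.

Definition acoef (alpha b gamma beta0 t : R) : R :=
  t ^+ 2 * (1 + ((alpha - b) * gamma * t - beta0 * (alpha + 1 - b)) /
                (t ^+ 2 - alpha * gamma * t - beta0 * (alpha + 1))).

Definition mcoef (L alpha b gamma beta0 t : R) : R :=
  Num.max t (Num.max (L * `|acoef alpha b gamma beta0 t * betaf gamma beta0 t|)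
                     (L * `|acoef alpha b gamma beta0 t| * betaf gamma beta0 t ^+ 2)).
End Defs.

(* Main.v *)
(** Put [k = (alpha - 3) / 2], [v = x + beta(t) x'] and [w = (k + 2)(x - xs) + t x'].
    Instead of the paper's energy, whose coefficient is [a(t)], we use
    [E(t) = t^2 (f v - f xs) + |w|^2 / 2 + (k + 2) k |x - xs|^2 / 2].
    Convexity and the equation give
    [E' <= - P + C (t + max(L, 0) t^2) |e| (1 + E)], where [P] is a positive
    combination of [t (f v - f xs)], [t^2 |grad f v|^2] and [t |x'|^2]: the cross
    term in [<grad f v, x'>] has a coefficient [O(t)] only and is absorbed by
    Young's inequality for large [t].  Since [a(t) ~ t^2] and [beta(t) -> gamma],
    the weight [t + max(L, 0) t^2] is bounded by a multiple of [m(t)] for large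
    [t], so with [H] a bounded primitive of it times [|e|], the function
    [(1 + E) exp(- C H)] is nonincreasing and its decay bounds the integral of
    [P].  This yields everything but (iii), which follows from
    [f x <= f v + |grad f v| |x - v| + L |x - v|^2]. *)
Require Import Defs.
From HB Require Import structures.
From mathcomp Require Import all_boot all_order all_algebra.
From mathcomp Require Import all_classical all_reals all_analysis.
From mathcomp Require Import ring lra.
Import Order.TTheory GRing.Theory Num.Theory.
Import numFieldNormedType.Exports.
Local Open Scope classical_set_scope.
Local Open Scope ring_scope.

Set Implicit Arguments.
Unset Strict Implicit.

(** * Inner products, gradients and derivatives of curves *)

Section calculus.
Context {R : realType} {V : normedModType R}.
Implicit Types (u w : R -> V) (s : R -> R) (t : R).

(** Turning [is_derive] into a limit of difference quotients lets the product rules below be proved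
    by algebra on the quotient. *)
Lemma is_derive_cvg {U : normedModType R} (u : R -> U) t du :
  is_derive t 1 u du <-> h^-1 *: (u (h + t) - u t) @[h --> 0^'] --> du.
Proof.
have E : (fun h : R => h^-1 *: ((u \o shift t) (h *: 1) - u t)) =
    (fun h : R => h^-1 *: (u (h + t) - u t)).
  by apply/funext => h /=; rewrite [h *: 1]mulr1.
split=> [[]|cu]; first by rewrite /derivable /derive E => + <-.
split; first by apply/cvg_ex; exists du; rewrite E.
by rewrite /derive E; exact: cvg_lim.
Qed.

Lemma is_derive_shift_cvg {U : normedModType R} (u : R -> U) t du :
  is_derive t 1 u du -> u (h + t) @[h --> 0^'] --> u t.
Proof.
move=> [+ _] => /derivable1_diffP/differentiable_continuous uc.
have : {for 0, continuous (fun h => u (h + t))}.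
  apply: continuous_comp; last by rewrite add0r.
  by apply: continuousD => //; exact: cst_continuous.
by move=> /continuous_withinNx; rewrite add0r.
Qed.

(** The quotient splits into the quotient of [s] times [w t], plus [s (h + t)] times the quotient of
    [w]. *)
Lemma is_derive_scale s w t ds dw :
  is_derive t 1 s ds -> is_derive t 1 w dw ->
  is_derive t 1 (fun t => s t *: w t) (ds *: w t + s t *: dw).
Proof.
move=> ds_ dw_; have sc := is_derive_shift_cvg ds_.
move: ds_ dw_ => /is_derive_cvg ds_ /is_derive_cvg dw_; apply/is_derive_cvg.
have -> : (fun h => h^-1 *: (s (h + t) *: w (h + t) - s t *: w t)) =
  (fun h => (h^-1 *: (s (h + t) - s t)) *: w t
            + s (h + t) *: (h^-1 *: (w (h + t) - w t))).
  apply/funext => h; rewrite !scalerA [s _ * _]mulrC -!scalerA -scalerDr.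
  congr (_ *: _); rewrite scalerBl scalerBr.
  by rewrite [X in _ = X]addrC addrA subrK.
by apply: cvgD; [exact: cvgZr_tmp | exact: cvgZ].
Qed.

Section inner_product.
Variable ip : V -> V -> R.
Hypothesis ipP : is_inner_product ip.

Lemma ipC x y : ip x y = ip y x. Proof. by case: ipP. Qed.

Lemma ip_norm x : ip x x = `|x| ^+ 2. Proof. by case: ipP. Qed.

Lemma ip0l y : ip 0 y = 0.
Proof. by case: ipP => _ /(_ (-1) 0 0 y); rewrite scaler0 addr0; lra. Qed.

Lemma ipDl x y z : ip (x + y) z = ip x z + ip y z.
Proof. by case: ipP => _ /(_ 1 x y z); rewrite scale1r mul1r. Qed.

Lemma ipZl a x z : ip (a *: x) z = a * ip x z.
Proof. by case: ipP => _ /(_ a x 0 z) + _; rewrite !addr0 ip0l addr0. Qed.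

Lemma ipDr x y z : ip z (x + y) = ip z x + ip z y.
Proof. by rewrite ![ip z _]ipC ipDl. Qed.

Lemma ipZr a x z : ip z (a *: x) = a * ip z x.
Proof. by rewrite ![ip z _]ipC ipZl. Qed.

Lemma ipNl x z : ip (- x) z = - ip x z.
Proof. by rewrite -scaleN1r ipZl mulN1r. Qed.

Lemma ipNr x z : ip z (- x) = - ip z x.
Proof. by rewrite ![ip z _]ipC ipNl. Qed.

Definition ipE := (ipDl, ipDr, ipZl, ipZr, ipNl, ipNr).

(** Polarization: since [ip] is a polynomial in norms, its continuity follows from that of the norm
    (see [cvg_ip]). *)
Lemma ip_polar x y : ip x y = (`|x + y| ^+ 2 - `|x - y| ^+ 2) / 4.
Proof. by rewrite -!ip_norm !ipE [ip y x]ipC; field. Qed.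

(** The squared norm of [|y|^2 x - <x, y> y] equals [|y|^2 (|x|^2 |y|^2 - <x, y>^2)]. *)
Lemma ip_cauchy x y : `|ip x y| <= `|x| * `|y|.
Proof.
have [->|y0] := eqVneq y 0.
  by rewrite ipC ip0l !normr0 mulr0.
have Y0 : 0 < `|y| by rewrite normr_gt0.
rewrite -ler_sqr ?nnegrE ?mulr_ge0// real_normK ?num_real//.
have : 0 <= `|(`|y| ^+ 2) *: x - ip x y *: y| ^+ 2 by exact: exprn_ge0.
rewrite -(ip_norm (_ - _)) !ipE [ip y x]ipC !ip_norm => H.
have : 0 <= `|y| ^+ 2 * (`|x| ^+ 2 * `|y| ^+ 2 - ip x y ^+ 2) by move: H; lra.
by rewrite pmulr_rge0 ?exprn_gt0// subr_ge0 exprMn.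
Qed.

Lemma ip_le x y : ip x y <= `|x| * `|y|.
Proof. exact: le_trans (ler_norm _) (ip_cauchy x y). Qed.

Lemma cvg_ip {T : Type} {F : set_system T} {FF : Filter F} (u w : T -> V) a c :
  u @ F --> a -> w @ F --> c -> ip (u t) (w t) @[t --> F] --> ip a c.
Proof.
move=> ua wc; under eq_fun do rewrite ip_polar.
rewrite ip_polar; apply: cvgM; last exact: cvg_cst.
have sqr_norm_cvg (v : T -> V) l : v @ F --> l -> `|v t| ^+ 2 @[t --> F] --> `|l| ^+ 2.
  by move=> vl; under eq_fun do rewrite expr2; rewrite expr2; apply: cvgM; exact: cvg_norm.
by apply: cvgB; apply: sqr_norm_cvg; [exact: cvgD | exact: cvgB].
Qed.

(** A difference of squares factors as [<u(h + t) + u(t), u(h + t) - u(t)>]; dividing the second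
    factor by [h] gives the limit. *)
Lemma is_derive_sqr_norm u t du :
  is_derive t 1 u du -> is_derive t 1 (fun t => `|u t| ^+ 2) (2 * ip (u t) du).
Proof.
move=> du_; have uc := is_derive_shift_cvg du_.
move: du_ => /is_derive_cvg du_; apply/is_derive_cvg.
have -> : (fun h => h^-1 *: (`|u (h + t)| ^+ 2 - `|u t| ^+ 2)) =
    (fun h => ip (u (h + t) + u t) (h^-1 *: (u (h + t) - u t))).
  apply/funext => h; rewrite -!ip_norm !ipE [ip (u t) (u (h + t))]ipC.
  by rewrite /GRing.scale/=; ring.
have -> : 2 * ip (u t) du = ip (u t + u t) du by rewrite ipDl; ring.
by apply: cvg_ip => //; apply: cvgD => //; exact: cvg_cst.
Qed.

Variables (f : V -> R) (g : V -> V).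
Hypothesis gradf : is_gradient ip f g.

Lemma gradient_continuous : continuous f.
Proof. by move=> x; apply: differentiable_continuous; case: (gradf x). Qed.

Lemma is_derive_gradient_comp u t du :
  is_derive t 1 u du -> is_derive t 1 (f \o u) (ip (g (u t)) du).
Proof.
move=> [du_ du1]; have /derivable1_diffP du' := du_.
have [df dfE] := gradf (u t).
have dfu : differentiable (f \o u) t by exact: differentiable_comp.
split; first exact/derivable1_diffP.
by rewrite deriveE// diff_comp//= dfE -du1 deriveE.
Qed.

(** For [0 < h <= 1], convexity bounds the difference quotient of [f] along the segment from [x] to
    [y] by [f y - f x]; the bound survives the limit as [h] decreases to 0. *)
Lemma convex_gradient_le x y : convex_fun f -> f x + ip (g x) (y - x) <= f y.
Proof.
move=> cf; have du : is_derive (0 : R) 1 (fun h : R => x + h *: (y - x)) (y - x).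
  apply/is_derive_cvg; apply: cvg_near_cst; near=> h.
  rewrite addr0 scale0r addr0 addrC addKr scalerA mulVf ?scale1r//.
  by near: h; exact: nbhs_dnbhs_neq.
have := is_derive_gradient_comp du; rewrite scale0r addr0 => /is_derive_cvg dfu.
rewrite -lerBrDl.
have dfr := cvg_dnbhs_at_right dfu.
apply: (closed_cvg (fun r => r <= f y - f x)) dfr; first exact: closed_le.
near=> h; rewrite /= addr0 scale0r addr0.
have h0 : 0 < h by near: h; exact: nbhs_right_gt.
rewrite ler_pdivrMl//.
have := cf y x h (ltW h0) (_ : h <= 1).
have -> : h *: y + (1 - h) *: x = x + h *: (y - x).
  by rewrite scalerBl scale1r scalerBr addrCA addrA.
suff h1 : h <= 1 by move=> /(_ h1); lra.
by near: h; exact: nbhs_right_le.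
Unshelve. all: by end_near. Qed.

End inner_product.
End calculus.

(** * Integrals over half-lines *)

Section integration.
Context {R : realType}.
Notation mu := (@lebesgue_measure R).
Implicit Types (h k W : R -> R) (a t u : R).

Lemma setge_itv a : [set t | a <= t] = `[a, +oo[%classic.
Proof. by apply/seteqP; split=> t /=; rewrite in_itv/= andbT. Qed.

Lemma continuous_within_integrable h a u :
  {within [set t | a <= t], continuous h} ->
  mu.-integrable `[a, u] (EFin \o h).
Proof.
rewrite setge_itv => hc; apply: continuous_compact_integrable.
  exact: segment_compact.
exact/continuous_subspaceW/hc/subset_itvl.
Qed.

Lemma continuous_within_gt {V : normedModType R} (h : R -> V) a t :
  {within [set t | a <= t], continuous h} -> a < t -> {for t, continuous h}.
Proof.
move=> hc at_; have : {within `]a, +oo[, continuous h}.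
  apply: continuous_subspaceW hc => s /=.
  by rewrite in_itv/= andbT => /ltW.
rewrite continuous_open_subspace; last exact: interval_open.
by apply; rewrite inE/= in_itv/= at_.
Qed.

(** The strict [a < t] turns continuity within the half-line into two-sided continuity at [t], as
    the fundamental theorem of calculus requires. *)
Lemma is_derive_primitive h a t :
  {within [set t | a <= t], continuous h} -> a < t ->
  is_derive t 1 (fun u => \int[mu]_(s in `[a, u]) h s)%R (h t).
Proof.
move=> hc at_; have [] := @continuous_FTC1 R h (BLeft a) t (t + 1).
- by rewrite ltrDl.
- exact: continuous_within_integrable.
- by rewrite lte_fin.
- exact: continuous_within_gt hc at_.
by move=> dH H; split; [exact: dH | rewrite -derive1E; exact: H].
Qed.

(** This will bound the primitive of the weighted error norm: [h] is continuous, so its primitive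
    can be differentiated, while the dominating [k] is only integrable. *)
Lemma primitive_le_integral h k a u :
  {within [set t | a <= t], continuous h} ->
  (forall t, a <= t -> 0 <= h t <= k t) ->
  mu.-integrable [set t | a <= t] (EFin \o k) ->
  (\int[mu]_(s in `[a, u]) h s)%R <= fine (\int[mu]_(s in [set t | (a <= t)%R]) (k s)%:E).
Proof.
move=> hc hk ik.
rewrite setge_itv in ik *.
rewrite -lee_fin /Rintegral fineK; last first.
  by apply: integrable_fin_num => //; exact: continuous_within_integrable.
rewrite fineK; last exact: integrable_fin_num.
have ik' : mu.-integrable `[a, u] (EFin \o k).
  by apply: integrableS ik => //; apply: subset_itvl.
apply: (@le_trans _ _ (\int[mu]_(s in `[a, u]) (k s)%:E)%E).
  apply: ge0_le_integral => //=.
  - by move=> t; rewrite in_itv/= => /andP[/hk/andP[h0 _] _]; rewrite lee_fin.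
  - have /integrableP[]// := @continuous_within_integrable h a u hc.
  - by case/integrableP: ik'.
  - by move=> t; rewrite in_itv/= => /andP[/hk/andP[_ ?] _]; rewrite lee_fin.
apply: ge0_subset_integral => //=.
- by case/integrableP: ik.
- move=> t; rewrite in_itv/= andbT => /hk/andP[h0 hk0].
  by rewrite lee_fin (le_trans h0).
- exact: subset_itvl.
Qed.

(** Monotone convergence along the segments [[a, a + n]]. *)
Lemma integral_ge_lty h a (M : R) :
  {within [set t | a <= t], continuous h} -> (forall t, a <= t -> 0 <= h t) ->
  (forall u, a <= u -> (\int[mu]_(s in `[a, u]) h s)%R <= M) ->
  (\int[mu]_(t in [set t | (a <= t)%R]) (h t)%:E < +oo)%E.
Proof.
move=> hc h0 hM.
have := @ge0_nondecreasing_set_cvg_integral _ (measurableTypeR R) R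
  (fun n : nat => `[a, a + n%:R]%classic) (EFin \o h) mu.
have -> : \bigcup_n `[a, a + n%:R]%classic = [set t | a <= t].
  apply/seteqP; split => t /=; first by move=> [n _] /=; rewrite in_itv/= => /andP[].
  move=> at_; exists (Num.truncn (t - a)).+1 => //=; rewrite in_itv/= at_/=.
  rewrite -lerBlDl; apply/ltW; apply: truncnS_gt.
move=> cv.
apply: (@le_lt_trans _ _ M%:E); last exact: ltry.
apply: (closed_cvg (fun x => (x <= M%:E)%E)) (cv _ _ _ _) => //.
- exact: closed_ereal_ge_ereal.
- apply: nearW => n.
  rewrite -(@fineK _ (integral _ _ _)).
    by rewrite lee_fin; apply: hM; rewrite lerDl.
  by apply: integrable_fin_num => //; exact: continuous_within_integrable.
- move=> m n mn; rewrite subsetEset; apply: subset_itvl.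
  by rewrite bnd_simp lerD2l ler_nat.
- by move=> i; have /integrableP[] := @continuous_within_integrable h a (a + i%:R) hc.
- by move=> i t /=; rewrite in_itv/= => /andP[/h0 ? _]; rewrite lee_fin.
Qed.

(** With [H] the primitive of [h], the function [W + c H] is nonincreasing for large times; as [W]
    is nonnegative, [H] stays bounded. *)
Lemma integral_lty_dissipation h W dW a T c :
  a <= T -> 0 < c -> {within [set t | a <= t], continuous h} ->
  (forall t, a <= t -> 0 <= h t) ->
  (forall t, T <= t -> is_derive t 1 W (dW t)) ->
  (forall t, T <= t -> c * h t <= - dW t) ->
  (forall t, T <= t -> 0 <= W t) ->
  (\int[mu]_(t in [set t | (a <= t)%R]) (h t)%:E < +oo)%E.
Proof.
move=> aT c0 hc h0 dWt dWle W0.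
pose H u := (\int[mu]_(s in `[a, u]) h s)%R.
pose Z := W + c *: H.
(* Starting at [T + 1] keeps times strictly above [a] even when [T = a], so that [H] is
   differentiable there. *)
have T1 : T < T + 1 by rewrite ltrDl.
have aT1 : a < T + 1 by rewrite (le_lt_trans aT).
have dZ t : T < t -> is_derive t 1 Z (dW t + c *: h t).
  move=> Tt; apply: is_deriveD; first exact/dWt/ltW.
  by apply/is_deriveZ/is_derive_primitive => //; exact: le_lt_trans Tt.
have Znincr u : T + 1 <= u -> Z u <= Z (T + 1).
  move=> Tu; apply: (@ler0_derive1_nincry R Z (T + 1) _ _ _ (T + 1) u (lexx _) Tu).
  - move=> t; rewrite in_itv/= andbT => Tt.
    by have [] := dZ t (lt_trans T1 Tt).
  - move=> t; rewrite in_itv/= andbT => /(lt_trans T1) Tt.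
    have [_] := dZ t Tt; rewrite derive1E => ->.
    have := dWle t (ltW Tt); rewrite /GRing.scale/=; lra.
  - apply: derivable_within_continuous => t; rewrite in_itv/= andbT => Tt.
    by have [] := dZ t (lt_le_trans T1 Tt).
have Hle u : T + 1 <= u -> H u <= c^-1 * Z (T + 1).
  move=> Tu; rewrite -ler_pdivrMl ?invr_gt0// invrK.
  have := Znincr u Tu; have := W0 u (le_trans (ltW T1) Tu).
  by rewrite /Z/= -![(W + _) _]/(W _ + c * H _); lra.
apply: (@integral_ge_lty h a (c^-1 * Z (T + 1))) => // u au.
(* Since [h] is nonnegative, enlarging [[a, u]] to reach [T + 1] only increases the integral. *)
apply: le_trans (Hle (Num.max u (T + 1)) _); last by rewrite le_max lexx orbT.
rewrite /H -lee_fin /Rintegral !fineK.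
- apply: ge0_subset_integral => //=.
  + by have /integrableP[] := @continuous_within_integrable h a (Num.max u (T + 1)) hc.
  + by move=> t; rewrite in_itv/= => /andP[/h0 ? _]; rewrite lee_fin.
  + by apply: subset_itvl; rewrite bnd_simp le_max lexx.
- by apply: integrable_fin_num => //; exact: continuous_within_integrable.
- by apply: integrable_fin_num => //; exact: continuous_within_integrable.
Qed.

End integration.

(** * Energy estimates *)

Section estimates.
Context {R : realType}.

(** With [n / d] the fraction in [acoef], large [t] gives [d >= 3 t^2 / 4] and [n >= - d / 2], so
    [acoef] is at least [t^2 / 2]. As [betaf >= gamma], the entry [L |a beta|] of the maximum
    controls [L t^2]; for [L <= 0] the entry [t] suffices. *)
Lemma mcoef_lower_bound (L alpha b gamma beta0 : R) :
  3 < alpha -> 0 < gamma -> 0 <= beta0 -> 0 < b -> b <= alpha - 1 ->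
  exists T C, 0 <= C /\ forall t, T <= t -> 1 <= t ->
    t + Num.max L 0 * t ^+ 2 <= C * mcoef L alpha b gamma beta0 t.
Proof.
move=> a3 g0 b0 bb0 ba.
(* For [t >= 1] the lower-order terms of the denominator total at most [q * t], and [4 * q <= t]
   makes this at most [t^2 / 4]. *)
pose q := alpha * gamma + beta0 * (alpha + 1).
have q0 : 0 <= q by apply: addr_ge0; apply: mulr_ge0; lra.
exists (4 * q), (1 + 2 / gamma); split; first by rewrite addr_ge0 ?divr_ge0//; lra.
move=> t Tt t1; have t0 : 0 < t by lra.
have tt : t <= t ^+ 2 by rewrite expr2; nra.
have qt : q * t <= t ^+ 2 / 4 by rewrite expr2; nra.
pose d := t ^+ 2 - alpha * gamma * t - beta0 * (alpha + 1).
pose n := (alpha - b) * gamma * t - beta0 * (alpha + 1 - b).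
have agt : 0 <= alpha * gamma by apply: mulr_ge0; lra.
have ba0 : 0 <= beta0 * (alpha + 1) by apply: mulr_ge0; lra.
have qE : alpha * gamma * t + beta0 * (alpha + 1) <= q * t.
  by rewrite /q mulrDl lerD2l; nra.
have d_ge : 3 / 4 * t ^+ 2 <= d by rewrite /d; lra.
have n1 : (alpha - b) * gamma * t <= alpha * gamma * t.
  by rewrite ler_pM2r// ler_pM2r//; lra.
have n2 : 0 <= (alpha - b) * gamma * t by rewrite !mulr_ge0//; lra.
have n3 : beta0 * (alpha + 1 - b) <= beta0 * (alpha + 1).
  by rewrite ler_wpM2l//; lra.
have n4 : 0 <= beta0 * (alpha + 1 - b) by rewrite mulr_ge0//; lra.
have agt0 : 0 <= alpha * gamma * t by rewrite mulr_ge0// ltW.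
have d0 : 0 < d by have := exprn_gt0 2 t0; lra.
have nd : - (d / 2) <= n by rewrite /n; lra.
have aE : t ^+ 2 / 2 <= `|acoef alpha b gamma beta0 t|.
  apply: le_trans (ler_norm _); rewrite /acoef -/d -/n ler_wpM2l ?sqr_ge0//.
  have : - 2^-1 <= n / d by rewrite ler_pdivlMr//; lra.
  lra.
have bE : gamma <= betaf gamma beta0 t.
  by rewrite /betaf lerDl divr_ge0// ltW.
have tm : t <= mcoef L alpha b gamma beta0 t by rewrite /mcoef le_max lexx.
rewrite mulrDl mul1r lerD// mulrAC ler_pdivlMr//.
have [L0|L0] := leP L 0; first by rewrite !mul0r; lra.
suff : L * t ^+ 2 * gamma / 2 <= mcoef L alpha b gamma beta0 t by lra.
apply: (@le_trans _ _ (L * `|acoef alpha b gamma beta0 t * betaf gamma beta0 t|)); last first.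
  by rewrite /mcoef !le_max lexx !orbT.
rewrite normrM (ger0_norm (le_trans (ltW g0) bE)).
have : t ^+ 2 / 2 * gamma <= `|acoef alpha b gamma beta0 t| * betaf gamma beta0 t.
  by rewrite ler_pM// ?divr_ge0 ?exprn_ge0// ltW.
rewrite -(ler_pM2l L0); lra.
Qed.

(** The integrating factor [X = exp(- C H)] absorbs the error: the derivative of [(1 + E) X] is at
    most [- P X], and [H <= M] bounds [X] below by [exp(- C M)]. *)
Lemma gronwall_dissipation (E dE h H P : R -> R) (T C M : R) :
  0 <= C ->
  (forall t, T <= t -> is_derive t 1 E (dE t)) ->
  (forall t, T <= t -> is_derive t 1 H (h t)) ->
  (forall t, T <= t -> H t <= M) ->
  (forall t, T <= t -> 0 <= E t) -> (forall t, T <= t -> 0 <= P t) ->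
  (forall t, T <= t -> dE t <= - P t + C * h t * (1 + E t)) ->
  exists W dW (c K : R), [/\ 0 < c,
    forall t, T <= t -> is_derive t 1 W (dW t),
    forall t, T <= t -> c * P t <= - dW t,
    forall t, T <= t -> 0 <= W t &
    forall t, T <= t -> E t <= K].
Proof.
move=> C0 dE_ dH_ HM E0 P0 dEle.
pose X t := expR (- C * H t).
pose W t := (1 + E t) * X t.
pose dW t := (dE t - C * h t * (1 + E t)) * X t.
have dX t : T <= t -> is_derive t 1 X (- C * h t * X t).
  move=> Tt; have dH := dH_ t Tt; have dCH := is_deriveZ (- C) dH.
  have := @is_derive1_comp _ expR (- C *: H) t _ _ (is_derive_expR _) dCH.
  by rewrite [X in is_derive _ _ _ X]mulrC.
have dW_ t : T <= t -> is_derive t 1 W (dW t).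
  move=> Tt; have dX' := dX t Tt; have dE' := dE_ t Tt.
  have d1E := is_deriveD (is_derive_cst (1 : R) t 1) dE'.
  have -> : dW t = (cst 1 + E) t *: (- C * h t * X t) + X t *: (0 + dE t).
    by rewrite /dW /GRing.scale/= -![(cst 1 + E) t]/(1 + E t); ring.
  exact: (is_deriveM d1E dX').
have X0 t : 0 < X t by exact: expR_gt0.
have XM t : T <= t -> expR (- C * M) <= X t.
  by move=> Tt; rewrite ler_expR ler_wnM2l ?oppr_le0//; exact: HM.
have c0 : 0 < expR (- C * M) by exact: expR_gt0.
have cP t : T <= t -> expR (- C * M) * P t <= - dW t.
  move=> Tt; apply: (@le_trans _ _ (X t * P t)).
    by rewrite ler_wpM2r ?P0 ?XM.
  by rewrite /dW -mulNr [leRHS]mulrC ler_pM2l//; have := dEle t Tt; lra.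
have W0 t : T <= t -> 0 <= W t.
  by move=> Tt; rewrite mulr_ge0 ?ltW// ltr_pwDl ?E0.
exists W, dW, (expR (- C * M)), ((expR (- C * M))^-1 * W T); split => // t Tt.
rewrite -ler_pdivrMl ?invr_gt0// invrK.
have WT : W t <= W T.
  apply: (@ler0_derive1_nincry R W T) => //.
  - by move=> s; rewrite in_itv/= andbT => /ltW Ts; have [] := dW_ s Ts.
  - move=> s; rewrite in_itv/= andbT => /ltW Ts; have [_] := dW_ s Ts.
    rewrite derive1E => ->; have := cP s Ts.
    have : 0 <= expR (- C * M) * P s by rewrite mulr_ge0 ?P0// ltW.
    lra.
  - apply: derivable_within_continuous => s; rewrite in_itv/= andbT => Ts.
    by have [] := dW_ s Ts.
apply: le_trans WT; rewrite /W mulrC ler_pM ?E0 ?XM ?expR_ge0//.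
by rewrite lerDr.
Qed.

End estimates.

(** * The differential inequality for the energy *)

Section energy.
Context {R : realType} {V : normedModType R}.
Variable ip : V -> V -> R.
Hypothesis ipP : is_inner_product ip.
Implicit Types (y p G e : V).

(* The derivative of [t^2 F + |(k+2) y + t p|^2 / 2 + (k+2) k |y|^2 / 2] along
   the flow, at a time where [y = x - xs], [p = x'], [G = g v] and [al = 2k + 3];
   the two long factors are [v'] and the derivative of [(k+2) y + t p]. *)
Lemma energy_derivative_le (t k al ga b0 be F K : R) y p G e :
  let w := (k + 2) *: y + t *: p in
  let a := - (al / t) *: p - G - e in
  al = 2 * k + 3 ->
  0 < t -> 0 < k -> 0 < ga -> ga <= be -> 0 <= b0 ->
  b0 + (k + 1) * be * t <= K * t -> K ^+ 2 <= ga * k * t ->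
  F <= ip G (y + be *: p) ->
  2 * t * F + t ^+ 2 * ip G (p + (- (b0 / t ^+ 2) *: p + be *: a))
    + ip w ((k + 2) *: p + (p + t *: a)) + (k + 2) * k * ip y p
  <= - (k * (t * F) + ga / 2 * (t ^+ 2 * `|G| ^+ 2) + k / 2 * (t * `|p| ^+ 2))
     + (be * t ^+ 2 * `|G| + t * `|w|) * `|e|.
Proof.
move=> w a alE t0 k0 ga0 gabe b00 Kt K2 FG.
have tn : t != 0 by rewrite gt_eqF.
(* Because [al = 2 k + 3], the second factor paired with [w] is [- k p - t G - t e]. Hence the
   [<y, p>] terms cancel, as do the [t^2 <G, p>] terms. *)
have -> : 2 * t * F + t ^+ 2 * ip G (p + (- (b0 / t ^+ 2) *: p + be *: a))
    + ip w ((k + 2) *: p + (p + t *: a)) + (k + 2) * k * ip y p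
  = 2 * t * F - t * (k + 2) * ip G y - (b0 + al * be * t) * ip G p
    - be * t ^+ 2 * `|G| ^+ 2 - k * t * `|p| ^+ 2
    - be * t ^+ 2 * ip G e - t * ip w e.
  rewrite /w /a !(ipE ipP) -!(ip_norm ipP) (ipC ipP y G) (ipC ipP p G) alE.
  by field.
have be0 : 0 < be by lra.
have Ge : - ip G e <= `|G| * `|e| by rewrite -ipNl// -normrN ip_le.
have we : - ip w e <= `|w| * `|e| by rewrite -ipNl// -normrN ip_le.
have Gp : - ip G p <= `|G| * `|p| by rewrite -ipNl// -normrN ip_le.
have {}FG : F <= ip G y + be * ip G p by move: FG; rewrite !(ipE ipP).
have t2 : 0 < t ^+ 2 by exact: exprn_gt0.
have h1 := ler_wpM2l (ltW (mulr_gt0 be0 t2)) Ge.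
have h2 := ler_wpM2l (ltW t0) we.
have k2 : 0 < t * (k + 2) by apply: mulr_gt0; lra.
have h3 := ler_wpM2l (ltW k2) FG.
have Kp : 0 <= b0 + (k + 1) * be * t.
  by rewrite addr_ge0// !mulr_ge0//; lra.
have h4 := ler_wpM2l Kp Gp.
have n0 : 0 <= `|G| * `|p| by rewrite mulr_ge0.
have h5 := ler_wpM2r n0 Kt.
(* Young: [K t |G| |p| <= ga t^2 |G|^2 / 2 + K^2 |p|^2 / (2 ga)] *)
have h6 : K * t * (`|G| * `|p|) <= ga / 2 * (t ^+ 2 * `|G| ^+ 2) + k / 2 * (t * `|p| ^+ 2).
  have h : K ^+ 2 / ga * `|p| ^+ 2 <= k * t * `|p| ^+ 2.
    by rewrite ler_wpM2r ?exprn_ge0// ler_pdivrMr//; lra.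
  have : 0 <= ga / 2 * (t * `|G| - K / ga * `|p|) ^+ 2.
    by rewrite mulr_ge0 ?sqr_ge0// divr_ge0// ltW.
  have -> : ga / 2 * (t * `|G| - K / ga * `|p|) ^+ 2 =
    ga / 2 * (t ^+ 2 * `|G| ^+ 2) - K * t * (`|G| * `|p|) + K ^+ 2 / ga * `|p| ^+ 2 / 2.
    by field; rewrite gt_eqF.
  lra.
have h7 : ga * (t ^+ 2 * `|G| ^+ 2) <= be * (t ^+ 2 * `|G| ^+ 2).
  by rewrite ler_wpM2r// mulr_ge0// ?exprn_ge0// ltW.
(* The [k + 2] share cancels against the [<G, p>] term of the convexity bound [h3]; the rest,
   together with [b0], is the coefficient bounded by [K * t]. *)
have alE' : al * be * t = (k + 1) * be * t + (k + 2) * be * t by rewrite alE; ring.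
rewrite alE'; move: h1 h2 h3 h4 h5 h6 h7; lra.
Qed.

(** From [2 r <= 1 + r^2]. The error enters the energy estimate linearly in such norms, which is why
    [1 + E] is the quantity propagated. *)
Lemma le_1_energy (b k t F : R) (y w : V) :
  0 < b -> 0 < k -> 0 <= F ->
  let E := t ^+ 2 * F + (`|w| ^+ 2 / 2 + b * k / 2 * `|y| ^+ 2) in
  [/\ `|w| <= 1 + E & `|y| <= (1 + (b * k)^-1) * (1 + E)].
Proof.
move=> b0 k0 F0 E.
have bk : 0 < b * k by exact: mulr_gt0.
have tF : 0 <= t ^+ 2 * F by rewrite mulr_ge0// sqr_ge0.
have y2 : 0 <= b * k / 2 * `|y| ^+ 2 by rewrite mulr_ge0 ?divr_ge0 ?sqr_ge0// ltW.
have w2 : 0 <= `|w| ^+ 2 / 2 by rewrite divr_ge0 ?sqr_ge0.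
split.
  have : 0 <= (`|w| - 1) ^+ 2 by exact: sqr_ge0.
  rewrite /E; lra.
have : 0 <= (`|y| - 1) ^+ 2 by exact: sqr_ge0.
have e1 : `|y| ^+ 2 / 2 <= (b * k)^-1 * E by rewrite ler_pdivlMl// /E; lra.
have e2 : 0 <= (b * k)^-1 by rewrite invr_ge0 ltW.
have e3 : 0 <= E by rewrite /E; lra.
lra.
Qed.

End energy.

(** * Differentiation of the energy along a trajectory *)

Section flow.
Context {R : realType} {V : normedModType R}.
Variables (ip : V -> V -> R) (f : V -> R) (g : V -> V).
Hypotheses (ipP : is_inner_product ip) (gradf : is_gradient ip f g).

Lemma is_derive_betaf (gamma beta0 t : R) : 0 < t ->
  is_derive t 1 (betaf gamma beta0) (- (beta0 / t ^+ 2)).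
Proof.
move=> t0; have tn : t != 0 by rewrite gt_eqF.
have dV : is_derive t (1 : R) (fun s : R => s^-1) (- (t ^- 2)).
  split; first exact: derivableV.
  by rewrite deriveV// derive_id /GRing.scale/= mulr1.
have -> : - (beta0 / t ^+ 2) = 0 + beta0 *: (- t ^- 2).
  by rewrite add0r /GRing.scale/= mulrN.
exact: (is_deriveD (is_derive_cst gamma t 1) (is_deriveZ beta0 dV)).
Qed.

(** The derivative is left unexpanded to match, for [b = k + 2], the left-hand side of
    [energy_derivative_le]. *)
Lemma is_derive_energy (xs : V) (b k gamma beta0 t : R) (x p : R -> V) (a : V) :
  0 < t -> is_derive t 1 x (p t) -> is_derive t 1 p a ->
  is_derive t 1
    (fun s => s ^+ 2 * (f (x s + betaf gamma beta0 s *: p s) - f xs)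
      + (`|b *: (x s - xs) + s *: p s| ^+ 2 / 2 + b * k / 2 * `|x s - xs| ^+ 2))
    (2 * t * (f (x t + betaf gamma beta0 t *: p t) - f xs)
     + t ^+ 2 * ip (g (x t + betaf gamma beta0 t *: p t))
         (p t + (- (beta0 / t ^+ 2) *: p t + betaf gamma beta0 t *: a))
     + ip (b *: (x t - xs) + t *: p t) (b *: p t + (p t + t *: a))
     + b * k * ip (x t - xs) (p t)).
Proof.
move=> t0 dx dp.
have dv : is_derive t 1 (fun s => x s + betaf gamma beta0 s *: p s)
    (p t + (- (beta0 / t ^+ 2) *: p t + betaf gamma beta0 t *: a)).
  exact: (is_deriveD dx (is_derive_scale (is_derive_betaf gamma beta0 t0) dp)).
have dy : is_derive t 1 (fun s => x s - xs) (p t).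
  by rewrite -[p t]subr0; exact: (is_deriveB dx (is_derive_cst xs t 1)).
have dw : is_derive t 1 (fun s => b *: (x s - xs) + s *: p s)
    (b *: p t + (p t + t *: a)).
  rewrite -[X in _ + (X + _)]scale1r.
  exact: (is_deriveD (is_deriveZ b dy) (is_derive_scale (is_derive_id t 1) dp)).
set v := fun s => x s + _ in dv *; set w := fun s => b *: _ + _ in dw *.
pose F s := f (v s) - f xs.
have dF : is_derive t 1 F (ip (g (v t))
    (p t + (- (beta0 / t ^+ 2) *: p t + betaf gamma beta0 t *: a))).
  rewrite -[X in is_derive _ _ _ X]subr0.
  exact: (is_deriveB (is_derive_gradient_comp gradf dv) (is_derive_cst (f xs) t 1)).
have dt2 : is_derive t 1 (fun s : R => s ^+ 2) (2 * t).
  by split; [exact: exprn_derivable | rewrite exp_derive /= expr1 [LHS]mulr1].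
have dt2F := is_deriveM dt2 dF.
have dw2 := is_deriveZ 2^-1 (is_derive_sqr_norm ipP dw).
have dy2 := is_deriveZ (b * k / 2) (is_derive_sqr_norm ipP dy).
have dE := is_deriveD dt2F (is_deriveD dw2 dy2).
set d := (X in is_derive _ _ _ X).
set u := (X in is_derive _ _ X _).
rewrite (_ : u = (fun s => s ^+ 2) * F + (2^-1 *: (fun s => `|w s| ^+ 2)
  + b * k / 2 *: (fun s => `|x s - xs| ^+ 2))); last first.
  by apply/funext => s; rewrite /u [_ / 2]mulrC.
rewrite (_ : d = t ^+ 2 *: ip (g (v t))
      (p t + (- (beta0 / t ^+ 2) *: p t + betaf gamma beta0 t *: a))
  + F t *: (2 * t) + (2^-1 *: (2 * ip (w t) (b *: p t + (p t + t *: a)))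
  + b * k / 2 *: (2 * ip (x t - xs) (p t)))); first exact: dE.
rewrite /d -/(v t) -/(w t) -/(F t).
move: (F t) (ip _ _) (ip _ _) (ip _ _) => r1 r2 r3 r4.
by rewrite /GRing.scale/=; field.
Qed.

End flow.

(** * Consequences of the Lipschitz condition on the gradient *)

Lemma lipschitz_continuous (R : realType) (V : normedModType R) (L : R) (g : V -> V) :
  lipschitz_with L g -> continuous g.
Proof.
move=> gL y; apply/cvgrPdist_lt => eps eps0; near=> z.
apply: le_lt_trans (gL y z) _.
apply: (@le_lt_trans _ _ ((`|L| + 1) * `|y - z|)).
  by rewrite ler_wpM2r// (le_trans (ler_norm L))// lerDl.
have L1 : 0 < `|L| + 1 by rewrite ltr_wpDl.
rewrite -ltr_pdivlMl//; near: z.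
by apply: (@cvgr_dist_lt _ _ _ _ _ id y); [exact: cvg_id | rewrite mulr_gt0// invr_gt0].
Unshelve. all: by end_near. Qed.

(* With [y = xs - s g xs], convexity between [y] and [xs] gives
   [ip (g y) (g xs) <= 0], hence [|g xs|^2 <= L s |g xs|^2]. *)
Lemma gradient_argmin_eq0 (R : realType) (V : normedModType R)
    (ip : V -> V -> R) (f : V -> R) (g : V -> V) (L : R) (xs : V) :
  is_inner_product ip -> convex_fun f -> is_gradient ip f g ->
  0 <= L -> lipschitz_with L g -> (forall y, f xs <= f y) -> g xs = 0.
Proof.
move=> ipP cf gradf L0 gL fmin.
(* Any positive [s] with [L * s < 1] would do; adding 1 covers [L = 0]. *)
pose s := (2 * (L + 1))^-1.
have s0 : 0 < s by rewrite invr_gt0; lra.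
have Ls : L * s <= 2^-1 by rewrite ler_pdivrMr; lra.
pose y := xs - s *: g xs.
have := convex_gradient_le gradf (y) (xs) cf.
have xy : xs - y = s *: g xs by rewrite /y opprB addrC subrK.
rewrite xy (ipZr ipP) => fy.
have gy : ip (g y) (g xs) <= 0.
  by rewrite -(pmulr_rle0 _ s0); have := fmin y; lra.
have := ip_le ipP (g xs - g y) (g xs); rewrite (ipDl ipP) (ipNl ipP) (ip_norm ipP) => gg.
have := gL xs y; rewrite xy normrZ gtr0_norm// => gLy.
have h1 := ler_wpM2r (normr_ge0 (g xs)) gLy.
have h2 := ler_wpM2r (sqr_ge0 `|g xs|) Ls.
apply/eqP; rewrite -normr_eq0 -sqrf_eq0 eq_le sqr_ge0 andbT.
move: gg h1 h2; lra.
Qed.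

(** * Rates and integral bounds for the trajectory *)

Unset Implicit Arguments.
Set Strict Implicit.

Theorem theorem7 (R : realType) (V : completeNormedModType R) (ip : V -> V -> R)
  (f : V -> R) (g : V -> V) (L t0 alpha gamma beta0 b : R)
  (e x : R -> V) (xs : V) :
  is_inner_product ip ->
  0 < t0 ->
  convex_fun f -> is_gradient ip f g -> lipschitz_with L g ->
  (forall y, f xs <= f y) ->
  3 < alpha -> 0 < gamma -> 0 <= beta0 -> 0 < b -> b <= alpha - 1 ->
  {within [set t | t0 <= t], continuous e} ->
  lebesgue_measure.-integrable [set t | t0 <= t]
    (fun t => (mcoef L alpha b gamma beta0 t * `|e t|)%:E) ->
  (forall t, t0 <= t -> derivable x t 1) ->
  {within [set t | t0 <= t], continuous (derive1 x)} ->
  (forall t, t0 < t -> derivable (derive1 x) t 1) ->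
  (forall t, t0 < t ->
     derive1 (derive1 x) t + (alpha / t) *: derive1 x t
     + g (x t + betaf gamma beta0 t *: derive1 x t) + e t = 0) ->
  [/\ (exists C T : R, forall t, T <= t ->
         f (x t + betaf gamma beta0 t *: derive1 x t) - f xs <= C / t ^+ 2),
      (exists C T : R, forall t, T <= t -> `|derive1 x t| <= C / t),
      (\int[lebesgue_measure]_(t in [set t | (t0 <= t)%R])
          (t * (f (x t) - f xs))%:E < +oo)%E,
      (\int[lebesgue_measure]_(t in [set t | (t0 <= t)%R])
          (t ^+ 2 * `|g (x t + betaf gamma beta0 t *: derive1 x t)| ^+ 2)%:E < +oo)%E &
      (\int[lebesgue_measure]_(t in [set t | (t0 <= t)%R])
          (t * `|derive1 x t| ^+ 2)%:E < +oo)%E].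
Proof.
move=> ipP t0_gt0 cf gradf gL fmin al3 ga0 be0 b0 bal ec eint dx pc dp ode.
set p := derive1 x in pc dp ode *.
pose v t := x t + betaf gamma beta0 t *: p t.
(* The sign of [L] is not assumed; [Lp] is a nonnegative Lipschitz constant. *)
pose Lp := Num.max L 0; have Lp0 : 0 <= Lp by rewrite le_max lexx orbT.
have gLp y z : `|g y - g z| <= Lp * `|y - z|.
  by apply: le_trans (gL y z) _; rewrite ler_wpM2r// le_max lexx.
pose k := (alpha - 3) / 2; have k0 : 0 < k by rewrite divr_gt0//; lra.
have alE : alpha = 2 * k + 3 by rewrite /k; lra.
have gxs : g xs = 0.
  exact: (gradient_argmin_eq0 ipP cf gradf Lp0 gLp fmin).
have gc := lipschitz_continuous gL.
have xc : {within [set t | t0 <= t], continuous x}.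
  rewrite setge_itv; apply: derivable_within_continuous => t.
  by rewrite in_itv/= andbT => /dx.
have betac : {within [set t | t0 <= t], continuous (betaf gamma beta0)}.
  rewrite setge_itv; apply: derivable_within_continuous => t.
  rewrite in_itv/= andbT => tt0.
  by have [] := is_derive_betaf gamma beta0 (lt_le_trans t0_gt0 tt0).
have idc : {within [set t | t0 <= t], continuous (fun t : R => t)}.
  by apply: continuous_subspaceT => t.
have sqrc (u : R -> R) : {within [set t | t0 <= t], continuous u} ->
    {within [set t | t0 <= t], continuous (fun t => u t ^+ 2)}.
  by move=> uc t; exact: (cvgM (uc t) (uc t)).
have vc : {within [set t | t0 <= t], continuous v}.
  by move=> t; apply: cvgD; [exact: xc | apply: cvgZ; [exact: betac | exact: pc]].
pose B := gamma + beta0; have B0 : 0 < B by rewrite ltr_wpDr.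
have beB t : 1 <= t -> gamma <= betaf gamma beta0 t <= B.
  move=> t1; rewrite /betaf lerD2l lerDl divr_ge0//=; last lra.
  by rewrite ler_pdivrMr ?ler_peMr//; lra.
have [T1 [C1 [C10 mlow]]] := mcoef_lower_bound L al3 ga0 be0 b0 bal.
pose Ta := Num.max t0 (Num.max 1 T1).
have Tat0 : t0 <= Ta by rewrite le_max lexx.
have Ta1 : 1 <= Ta by rewrite !le_max lexx !orbT.
have TaT1 : T1 <= Ta by rewrite !le_max lexx !orbT.
(* The error contributes [t |w| |e|] and [beta t^2 |g v| |e|]; the factor [Lp] comes from
   [|g v| <= Lp |v - xs|]. *)
pose h t := (t + Lp * t ^+ 2) * `|e t|.
have hc : {within [set t | Ta <= t], continuous h}.
  apply: (@continuous_subspaceW _ _ _ [set t | t0 <= t]).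
    by move=> t /= /(le_trans Tat0).
  move=> t; apply: cvgM; last by apply: cvg_norm; exact: ec.
  apply: cvgD; first exact: idc.
  apply: cvgM; first exact: cvg_cst.
  exact: (sqrc id).
pose H u := (\int[lebesgue_measure]_(s in `[Ta, u]) h s)%R.
pose m t := C1 * (mcoef L alpha b gamma beta0 t * `|e t|).
have hm t : Ta <= t -> 0 <= h t <= m t.
  move=> Tat; have t1 : 1 <= t by lra.
  rewrite /h /m [C1 * _]mulrA; apply/andP; split; last by rewrite ler_wpM2r// mlow//; lra.
  by rewrite mulr_ge0// addr_ge0 ?mulr_ge0 ?sqr_ge0//; lra.
have mint : lebesgue_measure.-integrable [set t | Ta <= t] (EFin \o m).
  have im : lebesgue_measure.-integrable [set t | Ta <= t]
      (fun t => (mcoef L alpha b gamma beta0 t * `|e t|)%:E).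
    rewrite !setge_itv in eint *; apply: integrableS eint => //.
    exact: subset_itvr.
  rewrite setge_itv in im *.
  by apply: (eq_integrable _ _ _ _ (integrableZl _ C1 im)).
pose M := fine (\int[lebesgue_measure]_(s in [set t | (Ta <= t)%R]) (m s)%:E).
have HM u : H u <= M by exact: primitive_le_integral.
have dH t : Ta < t -> is_derive t 1 H (h t) by exact: is_derive_primitive.
pose K := beta0 + (k + 1) * B.
(* The first entry keeps [t] strictly above [Ta], where [H] is differentiable; the second gives the
   largeness condition for Young's inequality. *)
pose T := Num.max (Ta + 1) (K ^+ 2 / (gamma * k)).
have TTa t : T <= t -> Ta + 1 <= t by rewrite ge_max => /andP[].
have TK t : T <= t -> K ^+ 2 <= gamma * k * t.
  have gk0 : 0 < gamma * k by exact: mulr_gt0.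
  by rewrite ge_max ler_pdivrMr// => /andP[_]; lra.
pose F t := f (v t) - f xs.
have F0 t : 0 <= F t by rewrite subr_ge0.
pose w t := (k + 2) *: (x t - xs) + t *: p t.
pose E t := t ^+ 2 * F t + (`|w t| ^+ 2 / 2 + (k + 2) * k / 2 * `|x t - xs| ^+ 2).
pose a t := - (alpha / t) *: p t - g (v t) - e t.
pose dE t := 2 * t * F t
  + t ^+ 2 * ip (g (v t)) (p t + (- (beta0 / t ^+ 2) *: p t + betaf gamma beta0 t *: a t))
  + ip (w t) ((k + 2) *: p t + (p t + t *: a t)) + (k + 2) * k * ip (x t - xs) (p t).
pose P t := k * (t * F t) + gamma / 2 * (t ^+ 2 * `|g (v t)| ^+ 2)
  + k / 2 * (t * `|p t| ^+ 2).
have dE_ t : T <= t -> is_derive t 1 E (dE t).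
  move=> /TTa Tt; have tt0 : t0 < t by lra.
  have t_gt0 : 0 < t by lra.
  have dxt : is_derive t 1 x (p t).
    by split; [apply/dx/ltW | rewrite /p derive1E].
  have dpt : is_derive t 1 p (a t).
    split; first exact: dp.
    rewrite -derive1E /a; apply/eqP; rewrite -subr_eq0 -(ode t tt0) -/(v t).
    by rewrite scaleNr !opprD !opprK !addrA.
  exact: (is_derive_energy ipP gradf xs (k + 2) k gamma beta0 t_gt0 dxt dpt).
have k20 : 0 < k + 2 by lra.
have Q0 t : 0 <= `|w t| ^+ 2 / 2 + (k + 2) * k / 2 * `|x t - xs| ^+ 2.
  have := sqr_ge0 `|w t|.
  have := mulr_ge0 (ltW (mulr_gt0 k20 k0)) (sqr_ge0 `|x t - xs|); lra.
have E0 t : 0 <= E t by rewrite addr_ge0 ?Q0// mulr_ge0 ?sqr_ge0 ?F0.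
pose D := 1 + ((k + 2) * k)^-1.
have wE t : `|w t| <= 1 + E t by have [] := le_1_energy t (x t - xs) (w t) k20 k0 (F0 t).
have yE t : `|x t - xs| <= D * (1 + E t).
  by have [] := le_1_energy t (x t - xs) (w t) k20 k0 (F0 t).
have D0 : 0 <= D by rewrite addr_ge0// invr_ge0 ltW// mulr_gt0.
have D10 : 0 <= 1 + (k + 2) * D by rewrite addr_ge0// mulr_ge0// ltW.
have pE t : 1 <= t -> t * `|p t| <= (1 + (k + 2) * D) * (1 + E t).
  move=> t1; have t_gt0 : 0 < t by lra.
  have -> : t * `|p t| = `|w t - (k + 2) *: (x t - xs)|.
    by rewrite /w addrC addKr normrZ gtr0_norm.
  apply: le_trans (ler_normB _ _) _; rewrite normrZ (gtr0_norm k20).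
  have := wE t; have := ler_wpM2l (ltW k20) (yE t); lra.
pose D2 := D + B * (1 + (k + 2) * D).
have D20 : 0 <= D2 by rewrite addr_ge0// mulr_ge0// ltW.
have vE t : 1 <= t -> `|v t - xs| <= D2 * (1 + E t).
  move=> t1; have /andP[be1 be2] := beB t t1.
  have -> : v t - xs = (x t - xs) + betaf gamma beta0 t *: p t by rewrite /v addrAC.
  apply: le_trans (ler_normD _ _) _; rewrite normrZ ger0_norm; last lra.
  have h1 : betaf gamma beta0 t * `|p t| <= B * `|p t| by rewrite ler_wpM2r.
  have h2 : `|p t| <= t * `|p t| by rewrite ler_peMl.
  have := ler_wpM2l (ltW B0) (le_trans h2 (pE t t1)).
  have := yE t; rewrite /D2; lra.
(* [B * D2] accounts for the gradient part of the error term and 1 for the part with [w]. *)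
pose C2 := B * D2 + 1.
have C20 : 0 <= C2 by rewrite addr_ge0// mulr_ge0// ltW.
have PF t : 1 <= t -> 0 <= k * (t * F t).
  by move=> t1; apply: mulr_ge0; [exact: ltW | rewrite mulr_ge0 ?F0//; lra].
have PG t : 0 <= gamma / 2 * (t ^+ 2 * `|g (v t)| ^+ 2).
  by apply: mulr_ge0; [lra | rewrite mulr_ge0 ?sqr_ge0].
have Pp t : 1 <= t -> 0 <= k / 2 * (t * `|p t| ^+ 2).
  by move=> t1; apply: mulr_ge0; [lra | rewrite mulr_ge0 ?sqr_ge0//; lra].
have T1t t : T <= t -> 1 <= t by move=> /TTa; lra.
have P0 t : T <= t -> 0 <= P t.
  by move=> /T1t t1; rewrite /P !addr_ge0 ?PF ?PG ?Pp.
have dEle t : T <= t -> dE t <= - P t + C2 * h t * (1 + E t).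
  move=> Tt; have := TTa t Tt => Tat; have t1 : 1 <= t by lra.
  have t_gt0 : 0 < t by lra.
  have /andP[be1 be2] := beB t t1.
  have Kle : beta0 + (k + 1) * betaf gamma beta0 t * t <= K * t.
    have k10 : 0 <= (k + 1) * t by apply: mulr_ge0; lra.
    have := ler_wpM2l k10 be2; have : beta0 <= beta0 * t by rewrite ler_peMr.
    rewrite /K; lra.
  have FG : F t <= ip (g (v t)) (x t - xs + betaf gamma beta0 t *: p t).
    have := convex_gradient_le gradf (v t) (xs) cf.
    have -> : xs - v t = - (x t - xs + betaf gamma beta0 t *: p t).
      by rewrite /v !opprD opprK addrA [xs - _]addrC.
    by rewrite (ipNr ipP) /F; lra.
  apply: le_trans (energy_derivative_le ipP (e t) alE t_gt0 k0 ga0 be1 be0 Kle (TK t Tt) FG) _.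
  rewrite lerD2l /h [C2 * _]mulrA [leRHS]mulrAC ler_wpM2r//.
  (* Since [g xs = 0], the gradient is controlled by the distance to [xs], hence by the energy. *)
  have Gv : `|g (v t)| <= Lp * (D2 * (1 + E t)).
    rewrite -[g (v t)]subr0 -gxs; apply: le_trans (gLp _ _) _.
    by rewrite ler_wpM2l// vE.
  have e1 : betaf gamma beta0 t * t ^+ 2 * `|g (v t)| <=
      B * t ^+ 2 * (Lp * (D2 * (1 + E t))).
    apply: ler_pM => //; first by rewrite mulr_ge0 ?sqr_ge0//; lra.
    by rewrite ler_wpM2r ?sqr_ge0.
  have e2 := ler_wpM2l (ltW t_gt0) (wE t).
  have E10 : 0 <= 1 + E t by rewrite addr_ge0 ?E0.
  have e3 : 0 <= B * D2 * t * (1 + E t).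
    by apply: mulr_ge0 => //; rewrite !mulr_ge0//; exact: ltW.
  have e4 : 0 <= Lp * t ^+ 2 * (1 + E t) by rewrite !mulr_ge0//; exact: ltW.
  rewrite -/(w t); move: e1 e2 e3 e4; rewrite /C2; lra.
have dH' t : T <= t -> is_derive t 1 H (h t) by move=> /TTa Tt; apply: dH; lra.
have [W [dW [c [K' [c0 dW_ cP W0 EK]]]]] :=
  gronwall_dissipation C20 dE_ dH' (fun t _ => HM t) (fun t _ => E0 t) P0 dEle.
have t0T : t0 <= T by have := TTa T (lexx T); lra.
split.
- exists K', T => t Tt; have := TTa t Tt => Tat.
  have t_gt0 : 0 < t by lra.
  rewrite ler_pdivlMr ?exprn_gt0// mulrC; apply: le_trans (EK t Tt).
  by rewrite /E lerDl.
- exists ((1 + (k + 2) * D) * (1 + K')), T => t Tt; have := TTa t Tt => Tat.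
  have t_gt0 : 0 < t by lra.
  rewrite ler_pdivlMr// mulrC; apply: le_trans (pE t _) _; first lra.
  by rewrite ler_wpM2l// lerD2l EK.
(* In [s1] below, [t (f x - f xs)] is bounded with coefficients 1, [B / 2] and [q / 2] on the three
   quantities making up [P]; [c'] scales these below [k], [gamma / 2] and [k / 2]. *)
- pose q := B + 2 * Lp * B ^+ 2.
  have q0 : 0 < q.
    by apply: ltr_wpDr => //; apply: mulr_ge0; [lra | exact: sqr_ge0].
  pose c' := Num.min k (Num.min (gamma / B) (k / q)).
  have c'0 : 0 < c' by rewrite !lt_min k0 (divr_gt0 ga0 B0) (divr_gt0 k0 q0).
  have c'1 : c' <= k by rewrite ge_min lexx.
  have c'2 : c' * B <= gamma by rewrite -ler_pdivlMr// !ge_min lexx !orbT.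
  have c'3 : c' * q <= k by rewrite -ler_pdivlMr// !ge_min lexx !orbT.
  apply: (@integral_lty_dissipation _ _ W dW t0 T (c * c')) => //.
  + exact: mulr_gt0.
  + move=> t; apply: cvgM; first exact: idc.
    apply: cvgB; last exact: cvg_cst.
    apply: (@continuous_comp (subspace [set t | t0 <= t]) V R x f); first exact: xc.
    exact: (gradient_continuous gradf).
  + by move=> t tt0; rewrite mulr_ge0 ?subr_ge0//; lra.
  + move=> t Tt; apply: le_trans (cP t Tt); rewrite -mulrA ler_pM2l//.
    have := TTa t Tt => Tat; have t1 : 1 <= t by lra.
    have /andP[be1 be2] := beB t t1.
    (* Convexity at [x t] gives a bound with the gradient at [x t]; the Lipschitz condition moves it
       to [v t] at a quadratic cost. *)
    have fx : f (x t) - f (v t) <= `|g (v t)| * (B * `|p t|) + Lp * (B * `|p t|) ^+ 2.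
      have := convex_gradient_le gradf (x t) (v t) cf.
      have -> : v t - x t = betaf gamma beta0 t *: p t by rewrite /v addrC addKr.
      set z := betaf gamma beta0 t *: p t => hx.
      have zB : `|z| <= B * `|p t|.
        by rewrite normrZ ger0_norm ?ler_wpM2r//; lra.
      have h1 : - ip (g (x t)) z <= `|g (x t)| * `|z|.
        by rewrite -(ipNl ipP) -normrN ip_le.
      have h2 : `|g (x t)| <= `|g (v t)| + Lp * `|z|.
        rewrite -[g (x t)](subrK (g (v t))) addrC.
        apply: le_trans (ler_normD _ _) _; rewrite lerD2l.
        apply: le_trans (gLp _ _) _; rewrite ler_wpM2l//.
        by rewrite -normrN opprB /v addrC addKr.
      have h3 := ler_wpM2r (normr_ge0 z) h2.
      have h4 := ler_wpM2l (normr_ge0 (g (v t))) zB.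
      have h5 : `|z| ^+ 2 <= (B * `|p t|) ^+ 2.
        by rewrite ler_sqr ?nnegrE// mulr_ge0// ltW.
      have := ler_wpM2l Lp0 h5; move: hx h1 h3 h4; lra.
    have t_gt0 : 0 < t by lra.
    have tF := mulr_ge0 (ltW t_gt0) (F0 t).
    have tG := mulr_ge0 (sqr_ge0 t) (sqr_ge0 `|g (v t)|).
    have tp := mulr_ge0 (ltW t_gt0) (sqr_ge0 `|p t|).
    have pp : `|p t| ^+ 2 <= t * `|p t| ^+ 2 by rewrite ler_peMl ?sqr_ge0.
    have Gp : t * `|g (v t)| * `|p t| <=
        (t ^+ 2 * `|g (v t)| ^+ 2 + t * `|p t| ^+ 2) / 2.
      have := sqr_ge0 (t * `|g (v t)| - `|p t|); lra.
    have s1 : t * (f (x t) - f xs) <= t * F t + B / 2 * (t ^+ 2 * `|g (v t)| ^+ 2)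
       + q / 2 * (t * `|p t| ^+ 2).
      have := ler_wpM2l (ltW t_gt0) fx; have := ler_wpM2l (ltW B0) Gp.
      by rewrite /F /q; lra.
    apply: le_trans (ler_wpM2l (ltW c'0) s1) _.
    have := ler_wpM2r tF c'1; have := ler_wpM2r tG c'2.
    have := ler_wpM2r tp c'3; rewrite /P; lra.
(* The integrand, up to the factor [gamma / 2], is one summand of [P]; the other two are
   nonnegative. The last integral is treated in the same way. *)
- apply: (@integral_lty_dissipation _ _ W dW t0 T (c * (gamma / 2))) => //.
  + by rewrite mulr_gt0// divr_gt0.
  + move=> t; apply: cvgM; first exact: (sqrc id).
    apply: (sqrc (fun t => `|g (v t)|)) => s; apply: cvg_norm.
    by apply: (@continuous_comp (subspace [set t | t0 <= t]) V V v g); [exact: vc|exact: gc].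
  + by move=> t _; rewrite mulr_ge0 ?sqr_ge0.
  + move=> t Tt; apply: le_trans (cP t Tt); rewrite -mulrA ler_pM2l//.
    by have := PF t (T1t t Tt); have := Pp t (T1t t Tt); rewrite /P; lra.
- apply: (@integral_lty_dissipation _ _ W dW t0 T (c * (k / 2))) => //.
  + by rewrite mulr_gt0// divr_gt0.
  + move=> t; apply: cvgM; first exact: idc.
    by apply: (sqrc (fun t => `|p t|)) => s; apply: cvg_norm; exact: pc.
  + by move=> t tt0; rewrite mulr_ge0 ?sqr_ge0//; lra.
  + move=> t Tt; apply: le_trans (cP t Tt); rewrite -mulrA ler_pM2l//.
    by have := PF t (T1t t Tt); have := PG t; rewrite /P; lra.
Qed.
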